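(* For every $\mathsf{u}\in\mathcal{A}$, the rightmost equitable partition of $\mathsf{u}$ equals the successful partition of $\mathsf{u}$; in particular the rightmost equitable partition of $\mathsf{u}$ is successful.
   Context: Fix positive integers $m,N$. Let $\mathcal{A}$ be the set of words $\mathsf{u}=\mathsf{u}_1\cdots\mathsf{u}_N$ of length $N$ over $\{0,1,\ldots,m-1\}$; write $|\mathsf{u}|=\sum_i\mathsf{u}_i$ and $|\mathsf{u}|_m=|\mathsf{u}|\bmod m$. A partitioned word of $\mathsf{u}$ is a decomposition $\mathsf{u}^*=\mathsf{u}^*_{m-1}|\cdots|\mathsf{u}^*_0$ of $\mathsf{u}$ into $m$ possibly empty consecutive factors (blocks) whose concatenation is $\mathsf{u}$; $\mathsf{block}(\mathsf{u}^*,i)=k$ if $\mathsf{u}_i$ lies in $\mathsf{u}^*_k$. The balancing array of $\mathsf{u}^*$ is the $N\times m$ array (rows $i=1..N$, columns $j=m-1,\ldots,0$) whose entry $(i,j)$ is filled iff $j\equiv\mathsf{block}(\mathsf{u}^*,i)-t\pmod m$ for some $0\le t\le\mathsf{u}_i-1$. Column $j$ is equitably filled if it has exactly $\lfloor|\mathsf{u}|/m\rfloor+1$ filled entries when $1\le j\le|\mathsf{u}|_m$ and exactly $\lfloor|\mathsf{u}|/m\rfloor$ when $j=0$ or $j>|\mathsf{u}|_m$; $\mathsf{u}^*$ is an equitable partition if all columns are equitably filled. The rightmost equitable partition of $\mathsf{u}$ is the (unique) equitable partition $\mathsf{u}^*$ such that every equitable partition $\mathsf{v}^*$ of $\mathsf{u}$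 has $\mathsf{block}(\mathsf{v}^*,i)\ge\mathsf{block}(\mathsf{u}^*,i)$ for all $i$. Successful partitions: on a partitioned word $\mathsf{u}^*$, set $L:=|\mathsf{u}|_m$ and repeat $N$ times: if block $\mathsf{u}^*_L$ (of not-yet-removed letters) is empty, stop and fail; otherwise remove its leftmost remaining letter $x$ and set $L:=(L-x)\bmod m$. If all $N$ steps complete, $\mathsf{u}^*$ is a successful partition of $\mathsf{u}$. It is known that every $\mathsf{u}\in\mathcal{A}$ has exactly one successful partition, called the successful partition of $\mathsf{u}$. *)

(* Defs.v *)
From mathcomp Require Import all_boot.

Set Implicit Arguments.
Unset Strict Implicit.
Unset Printing Implicit Defensive.

Section PartitionedWords.

Variables m N : nat.

Definition word := N.-tuple 'I_m.

Definition weight (u : word) : nat := \sum_(i < N) tnth u i.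

(* Entry k is the block u*_k. The decomposition of the word is written
   u*_{m-1} | ... | u*_0, so block 0 comes last: hence the [rev]s below. *)
Definition blocks := m.-tuple (seq 'I_m).

Definition partition_of (u : word) (p : blocks) : bool :=
  flatten (rev p) == u.

(* [reshape_index] numbers the factors from left to right, starting at 0. *)
Definition block (p : blocks) (i : 'I_N) : nat :=
  m.-1 - reshape_index (shape (rev p)) i.

(* j = block - t mod m, with t moved to the left because [subn] truncates. *)
Definition filled (u : word) (p : blocks) (i : 'I_N) (j : 'I_m) : bool :=
  [exists t : 'I_(tnth u i), j + t == block p i %[mod m]].

Definition equitably_filled (u : word) (p : blocks) (j : 'I_m) : bool :=
  #|[set i | filled u p i j]| ==
    if 1 <= j <= weight u %% m then (weight u %/ m).+1 else weight u %/ m.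

Definition equitable (u : word) (p : blocks) : bool :=
  partition_of u p && [forall j, equitably_filled u p j].

Definition rightmost_equitable (u : word) (p : blocks) : Prop :=
  equitable u p /\
  forall q : blocks, equitable u q -> forall i : 'I_N, block p i <= block q i.

(* n steps of the removal procedure from level L; m is added before
   subtracting the letter x < m because [subn] truncates. *)
Fixpoint removal (n : nat) (p : seq (seq 'I_m)) (L : nat) : bool :=
  if n is n'.+1 then
    if nth [::] p L is x :: s then
      removal n' (set_nth [::] p L s) ((L + m - x) %% m)
    else false
  else true.

Definition successful (u : word) (p : blocks) : bool :=
  partition_of u p && removal N p (weight u %% m).

End PartitionedWords.

(* Main.v *)
(* Removing a letter x at level L covers the columns L, L-1, .., L-x+1
   cyclically, so a complete walk covers all columns equitably: a successful
   partition is equitable. Conversely let p be successful and q equitable, and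
   let W be the set of columns j crossed by some letter on its way up from q to
   p, that is, block q i < j <= block p i. Comparing the column counts of p and
   q shows that the last letter of a block of p in W again leads to a level in
   W. But in a successful walk, following last letters from a visited level ends
   at 0, which is not in W; so W is empty and p is to the right of q. Hence a
   word has at most one successful partition. Since a successful partition and
   the sequence of letters removed from it determine each other, sending this
   sequence to the partitioned word is an injective map from the finite set of
   words to itself, hence onto: every word has a successful partition. *)

Require Import Defs.
From mathcomp Require Import all_boot.
From mathcomp Require Import zify.

Set Implicit Arguments.
Unset Strict Implicit.
Unset Printing Implicit Defensive.

(** * Factors of a flattened sequence as sets of positions *)

Lemma nth_reshape_index (T : Type) (x0 : T) (ss : seq (seq T)) r :
  nth [::] ss r =
  [seq nth x0 (flatten ss) i | i <- iota 0 (size (flatten ss))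
                             & reshape_index (shape ss) i == r].
Proof.
elim: ss r => [|s ss IHss] r; first by rewrite nth_nil.
have indexE i : reshape_index (size s :: shape ss) i =
    if i < size s then 0 else (reshape_index (shape ss) (i - size s)).+1.
  by rewrite /reshape_index /= subn_eq0; case: ltnP => // le_s_i; rewrite subSn.
rewrite [flatten _]/= size_cat iotaD filter_cat map_cat add0n.
rewrite -[X in iota X (size (flatten _))]addn0 iotaDl filter_map -map_comp.
rewrite (@eq_in_filter _ _ (fun=> 0 == r)); last first.
  by move=> i; rewrite mem_iota /= indexE => ->.
rewrite [X in _ ++ map _ X](@eq_filter _ _
  (fun i => (reshape_index (shape ss) i).+1 == r)); last first.
  by move=> i /=; rewrite indexE ltnNge leq_addr addKn.
rewrite [X in _ ++ X](@eq_map _ _ _ (nth x0 (flatten ss))); last first.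
  by move=> i /=; rewrite nth_cat ltnNge leq_addr addKn.
case: r => [|r] /=.
  rewrite filter_pred0 cats0 filter_predT.
  rewrite -[LHS](mkseq_nth x0); apply/eq_in_map => i.
  by rewrite mem_iota nth_cat /= => ->.
by rewrite filter_pred0 /= IHss; congr (map _ _); apply: eq_filter.
Qed.

Lemma leq_reshape_index sh : {homo reshape_index sh : i j / i <= j}.
Proof.
rewrite /reshape_index; elim: sh => [|n sh IHsh] i j le_ij //=.
rewrite !subn_eq0; case: (ltnP i n) => //= le_n_i.
rewrite [j < n]ltnNge (leq_trans le_n_i le_ij) /= ltnS !subSn ?(leq_trans le_n_i) //.
by apply: IHsh; rewrite leq_sub2r.
Qed.

(** * Cyclic descents and the levels they leave *)

Section CyclicCover.

Variables (m : nat) (m_gt0 : 0 < m).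

(* How often a descent of n steps from level b leaves level j modulo m. *)
Definition cover b n j : nat := \sum_(t < n) (j + t == b %[mod m]).

Lemma cover_mod b c n j : b = c %[mod m] -> cover b n j = cover c n j.
Proof. by move=> eq_bc; rewrite /cover eq_bc. Qed.

(** After its first [n1] steps the descent stands at [b]. *)
Lemma cover_add b n1 n2 j :
  cover (b + n1) (n1 + n2) j = cover (b + n1) n1 j + cover b n2 j.
Proof.
rewrite /cover big_split_ord /=; congr (_ + _); apply: eq_bigr => t _.
by rewrite [n1 + t]addnC addnA eqn_modDr.
Qed.

Lemma sum_cong_mod1 b c : \sum_(t < m) (c + t == b %[mod m]) = 1.
Proof.
pose t0 := Ordinal (ltn_pmod (b + (m - c %% m)) m_gt0).
have t0E : c + t0 = b %[mod m].
  rewrite /= modnDmr addnCA -modnDmr -(modnDml c) subnKC.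
    by rewrite modnn addn0.
  by rewrite ltnW ?ltn_mod.
rewrite (bigD1 t0) //= t0E eqxx big1 // => t neq_t.
apply/eqP; rewrite eqb0 -t0E eqn_modDl !modn_small ?ltn_mod //.
Qed.

Lemma cover_mulm b q j : cover b (q * m) j = q.
Proof.
elim: q => [|q IHq]; first by rewrite /cover big_ord0.
rewrite mulSn (cover_mod _ _ (esym (modnDr b m))) cover_add IHq.
by rewrite /cover sum_cong_mod1.
Qed.

Lemma sum_cover b n : \sum_(j < m) cover b n j = n.
Proof.
rewrite exchange_big /= (eq_bigr (fun=> 1)) ?sum1_card ?card_ord // => t _.
by rewrite -[RHS](sum_cong_mod1 b t); apply: eq_bigr => j _; rewrite addnC.
Qed.

(** A descent from [f < m] to [g] never wraps around, so congruences become equalities; for [f <= g]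
    truncation makes both sides 0. *)
Lemma cover_interval g f j : f < m -> j < m -> cover f (f - g) j = (g < j <= f).
Proof.
move=> lt_f lt_j; case: (boolP (g < j <= f)) => [/andP[lt_gj le_jf]|not_gjf].
  have lt_t0 : f - j < f - g by lia.
  rewrite /cover (bigD1 (Ordinal lt_t0)) //= subnKC // eqxx big1 // => t neq_t.
  apply/eqP; rewrite eqb0; apply: contra neq_t => /eqP eq_t.
  apply/eqP/val_inj => /=; move/eqP: eq_t.
  have lt_t := ltn_ord t; rewrite -{2}(subnKC le_jf) eqn_modDl.
  by rewrite !modn_small => [/eqP||]; lia.
rewrite /cover big1 // => t _; apply/eqP; rewrite eqb0.
apply: contra not_gjf => /eqP; rewrite (modn_small lt_f) => eq_t.
have lt_t := ltn_ord t; move: eq_t; case: (ltnP (j + t) m) => [lt_jt|le_m_jt].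
  by rewrite modn_small //; lia.
rewrite -(subnK le_m_jt) modnDr modn_small; lia.
Qed.

(** The [M %/ m] full turns leave each level once apiece; the remaining [M %% m] steps leave the
    levels from [M %% m] down to 1. *)
Lemma cover_diag M j : j < m ->
  cover M M j = if 1 <= j <= M %% m then (M %/ m).+1 else M %/ m.
Proof.
move=> lt_j; rewrite {1 2}(divn_eq M m).
rewrite -(cover_mod _ _ (_ : M %% m + M %/ m * m = _ %[mod m])); last first.
  by rewrite addnC.
rewrite cover_add cover_mulm -{2}[M %% m]subn0.
rewrite cover_interval ?ltn_mod //; case: ifP => _; lia.
Qed.

(** Both sides split one descent of [(f - g) + n] steps from [f], at [g] or at [f - n]; the added
    [m] prevents truncation. *)
Lemma cover_exchange f g n j : g <= f -> n <= m ->
  cover f (f - g) j + cover g n j = cover f n j + cover (f + m - n) (f - g) j.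
Proof.
move=> le_gf le_nm.
have := cover_add g (f - g) n j; rewrite subnKC // => <-.
rewrite -(cover_mod n j (modnDr f m)) -(cover_mod _ j (modnDr f m)).
have := cover_add (f + m - n) n (f - g) j; rewrite subnK; last by lia.
by rewrite [n + _]addnC.
Qed.

End CyclicCover.

(** * Blocks as lists of letters and as sets of positions *)

Section Blocks.

Variables (m N : nat) (m_gt0 : 0 < m).

Implicit Types (u : word m N) (p q : blocks m) (i : 'I_N) (s : seq (seq 'I_m)).

Lemma ltn_block p i : block p i < m.
Proof. by rewrite /block; lia. Qed.

Lemma leq_block p i i' : i <= i' -> block p i' <= block p i.
Proof. by move=> le_ii'; rewrite leq_sub2l ?leq_reshape_index. Qed.

Lemma block_letters u p k : k < m -> partition_of u p ->
  nth [::] p k = [seq tnth u i | i <- enum 'I_N & block p i == k].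
Proof.
move=> lt_km /eqP def_u.
have -> : nth [::] p k = nth [::] (rev p) (m - k.+1).
  rewrite nth_rev ?size_tuple; first congr (nth _ _ _); lia.
rewrite (nth_reshape_index (Ordinal lt_km)) def_u size_tuple -val_enum_ord.
rewrite filter_map -map_comp (@eq_filter _ _ (fun i => block p i == k)).
  by apply: eq_map => i /=; rewrite -tnth_nth.
move=> i /=; rewrite /block.
(* As [i] lies within the flattened length, its factor index is below [m], so the subtraction in
   [block] does not truncate. *)
have lt_i : i < sumn (shape (rev p)).
  by rewrite -size_flatten def_u size_tuple.
have := reshape_indexP lt_i; rewrite size_map size_rev size_tuple; lia.
Qed.

(** Takes any list of blocks, since the blocks shrink during the removal. *)
Definition block_sum (F : nat -> 'I_m -> nat) s : nat :=
  \sum_(k < m) \sum_(x <- nth [::] s k) F k x.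

Lemma sum_block F u p : partition_of u p ->
  \sum_(i < N) F (block p i) (tnth u i) = block_sum F p.
Proof.
move=> up; rewrite (partition_big (fun i => Ordinal (ltn_block p i)) predT) //=.
apply: eq_bigr => k _; rewrite (block_letters _ up) // big_map big_filter.
rewrite big_enum_cond /=; by apply: congr_big => // i /eqP <-.
Qed.

Lemma block_sum_set F s L x r : L < m -> nth [::] s L = x :: r ->
  block_sum F s = F L x + block_sum F (set_nth [::] s L r).
Proof.
move=> lt_L sL; rewrite /block_sum.
rewrite [LHS](bigD1 (Ordinal lt_L)) // [in RHS](bigD1 (Ordinal lt_L)) //=.
rewrite sL nth_set_nth /= eqxx big_cons -addnA; congr (_ + (_ + _)).
by apply: eq_bigr => k neq_k; rewrite nth_set_nth /= ifN.
Qed.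

Lemma block_sum_eq0 s : block_sum (fun _ _ => 1) s = 0 ->
  forall k, k < m -> nth [::] s k = [::].
Proof.
move=> /eqP; rewrite sum_nat_eq0 => /forallP s0 k lt_k.
by have := s0 (Ordinal lt_k); rewrite /= sum1_size; case: nth.
Qed.

Lemma partition_inj u p q :
  partition_of u p -> partition_of u q ->
  (forall i : 'I_N, block p i = block q i) -> p = q.
Proof.
move=> up uq eq_pq; apply: val_inj; apply: (@eq_from_nth _ [::]).
  by rewrite !size_tuple.
move=> k; rewrite size_tuple => lt_k; rewrite (block_letters _ up) //.
rewrite (block_letters _ uq) //; congr (map _ _).
by apply: eq_filter => i; rewrite eq_pq.
Qed.

(** * The removal walk *)

Lemma modn_next_level L M x :
  x < m -> L = x + M %[mod m] -> (L + m - x) %% m = M %[mod m].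
Proof.
move=> lt_xm eq_L; apply/eqP; rewrite modn_mod -(eqn_modDr x) subnK; last by lia.
by rewrite modnDr eq_L addnC.
Qed.

Local Notation letters s := (block_sum (fun _ _ => 1) s).
Local Notation total s := (block_sum (fun _ x => nat_of_ord x) s).

(** The level stays congruent to the total of the remaining letters, so the descents of successive
    letters join into a single one. *)
Lemma removal_cover n s L j : removal n s L -> L < m -> letters s = n ->
  L = total s %[mod m] ->
  block_sum (fun k x => cover m k x j) s = cover m (total s) (total s) j.
Proof.
elim: n s L => [|n IHn] s L /=.
  move=> _ _ /block_sum_eq0 s0 _; have block_sum0 F : block_sum F s = 0.
    by rewrite /block_sum big1 // => k _; rewrite s0 ?big_nil.
  by rewrite !block_sum0 /cover big_ord0.
case sL: nth => [//|x r] rem lt_L; rewrite !(block_sum_set _ lt_L sL) /= add1n.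
move=> [size_s] eq_L.
rewrite (IHn _ _ rem) ?ltn_mod //; last exact: modn_next_level.
rewrite (cover_mod _ _ eq_L); set M := block_sum _ _.
by have := cover_add m M x M j; rewrite [M + x]addnC => ->.
Qed.

(* A walk that uses up every letter ends at level 0, and it leaves each level
   for the last time by the last letter of that block. So following last letters
   from a visited level always leads to 0. *)
Lemma removal_closed n s L (W : pred nat) :
    removal n s L -> L < m -> letters s = n -> L = total s %[mod m] -> ~~ W 0 ->
    (forall k x r, k < m -> W k -> nth [::] s k = rcons r x ->
      W ((k + m - x) %% m)) ->
  ~~ W L /\ forall k, k < m -> W k -> nth [::] s k = [::].
Proof.
move=> rem lt_L size_s eq_L W0; elim: n s L rem lt_L size_s eq_L.
  move=> s L _ lt_L /block_sum_eq0 s0 eq_L _; split=> [|k lt_k _]; last exact: s0.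
  suff -> : L = 0 by [].
  rewrite -(modn_small lt_L) eq_L /block_sum big1 ?mod0n // => k _.
  by rewrite s0 ?big_nil.
move=> n IHn s L /=; case sL: nth => [//|x r] rem lt_L.
rewrite !(block_sum_set _ lt_L sL) add1n => -[size_s] eq_L Wclosed.
have next_nth k : nth [::] (set_nth [::] s L r) k = if k == L then r else nth [::] s k.
  by rewrite nth_set_nth.
have [|notW' empty_s] :=
  IHn _ _ rem (ltn_pmod _ m_gt0) size_s (modn_next_level (ltn_ord x) eq_L).
  move=> k y r' lt_k Wk; rewrite next_nth; case: eqP => [eq_k r_def|_].
    by apply: (Wclosed k y (x :: r')); rewrite // eq_k sL r_def.
  exact: Wclosed.
(* If [L] were in [W], induction would make [r] empty, so [x] would be the last letter of its block
   and lead to a level in [W], against [notW']. *)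
have notWL : ~~ W L.
  apply: contra notW' => WL; apply: (Wclosed L x [::]) => //.
  by have := empty_s L lt_L WL; rewrite next_nth eqxx sL => ->.
split=> // k lt_k Wk; have := empty_s k lt_k Wk; rewrite next_nth.
by case: eqP => // eq_k; rewrite eq_k (negPf notWL) in Wk.
Qed.

Lemma successful_removal u p : successful u p ->
  [/\ partition_of u p, removal N p (weight u %% m), letters p = N &
      weight u = total p].
Proof.
case/andP=> up rem; split=> //.
  by rewrite -(sum_block _ up) sum1_card card_ord.
by rewrite /weight (sum_block (fun _ x => nat_of_ord x) up).
Qed.

(** * Comparison with equitable partitions *)

Lemma card_filled u p j :
  #|[set i | filled u p i j]| = \sum_(i < N) cover m (block p i) (tnth u i) j.
Proof.
rewrite -sum1_card big_mkcond /=; apply: eq_bigr => i _; rewrite inE /filled.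
case: existsP => [[t eq_t]|no_t]; last first.
  rewrite /cover big1 // => t _; apply/eqP; rewrite eqb0.
  by apply/negP => eq_t; case: no_t; exists t.
(* A letter is below [m], so its descent leaves no level twice. *)
rewrite /cover (bigD1 t) //= eq_t big1 // => t' neq_t.
apply/eqP; rewrite eqb0 -(eqP eq_t) eqn_modDl !modn_small //.
  exact: ltn_trans (ltn_ord _) (ltn_ord _).
exact: ltn_trans (ltn_ord _) (ltn_ord _).
Qed.

Lemma equitable_cover u p (j : 'I_m) : equitable u p ->
  \sum_(i < N) cover m (block p i) (tnth u i) j = cover m (weight u) (weight u) j.
Proof.
case/andP=> _ /forallP/(_ j)/eqP; rewrite card_filled => ->.
by rewrite cover_diag.
Qed.

Lemma successful_equitable u p : successful u p -> equitable u p.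
Proof.
case/successful_removal=> up rem size_p weight_u; rewrite /equitable up.
apply/forallP => j; rewrite /equitably_filled card_filled -cover_diag //.
rewrite (sum_block (fun k x => cover m k x j) up) weight_u.
by rewrite (removal_cover _ rem) ?ltn_mod ?modn_mod // weight_u.
Qed.

(** Block numbers decrease weakly along the word, so nothing after the last position of block [k]
    lies in a block numbered [k] or more. *)
Lemma block_last u p k r x :
    k < m -> partition_of u p -> nth [::] p k = rcons r x ->
  exists i, [/\ block p i = k, tnth u i = x & forall i', k <= block p i' -> i' <= i].
Proof.
move=> lt_k up; rewrite (block_letters _ up) //.
have: sorted (fun i i' : 'I_N => i < i') [seq i <- enum 'I_N | block p i == k].
  apply: sorted_filter => [i1 i2 i3|]; first exact: ltn_trans.
  by rewrite -(@sorted_map _ _ val ltn) val_enum_ord iota_ltn_sorted.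
case/lastP def_e: [seq i <- _ | _] => [|e i]; first by case: r.
rewrite map_rcons sorted_pairwise; last by move=> i1 i2 i3; apply: ltn_trans.
rewrite pairwise_rcons => /andP[/allP max_i _] /rcons_inj[_ <-].
have mem_e i' : (i' \in rcons e i) = (block p i' == k).
  by rewrite -def_e mem_filter mem_enum andbT.
have block_i : block p i = k by apply/eqP; rewrite -mem_e mem_rcons mem_head.
exists i; split=> // i' le_k; case: (leqP i' i) => // lt_ii'.
have := mem_e i'; rewrite eqn_leq le_k andbT -block_i leq_block ?(ltnW lt_ii') //.
rewrite mem_rcons inE => /orP[/eqP eq_i|/max_i].
  by rewrite eq_i ltnn in lt_ii'.
by rewrite /= ltnNge ltnW.
Qed.

(* A letter moving up from q to p enters the columns that its top passes and
   leaves those that its bottom passes. The column counts of p and q agree, and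
   no column is passed by tops in both directions, so in each column the upward
   moving tops are at most as many as the upward moving bottoms; summing over
   all columns gives equality. *)
Lemma equitable_crossings u p q (j : 'I_m) : equitable u p -> equitable u q ->
  \sum_(i < N) (block q i < j <= block p i) =
  \sum_(i < N) cover m (block p i + m - tnth u i) (block p i - block q i) j.
Proof.
move=> eq_p eq_q.
pose up (j : 'I_m) := \sum_(i < N) (block q i < j <= block p i).
pose down (j : 'I_m) := \sum_(i < N) (block p i < j <= block q i).
pose up' (j : 'I_m) :=
  \sum_(i < N) cover m (block p i + m - tnth u i) (block p i - block q i) j.
pose down' (j : 'I_m) :=
  \sum_(i < N) cover m (block q i + m - tnth u i) (block q i - block p i) j.
have balance k : up k + down' k = up' k + down k.
  (* The added column count is read through [q] on the left and through [p] on the right, which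
     reduces the balance to one letter. *)
  apply/eqP; rewrite -(eqn_add2r (cover m (weight u) (weight u) k)); apply/eqP.
  rewrite -{1}(equitable_cover k eq_q) -(equitable_cover k eq_p).
  rewrite -!big_split; apply: eq_bigr => i _ /=.
  rewrite -!(cover_interval m_gt0) ?ltn_block //.
  have cover0 b : cover m b 0 k = 0 by rewrite /cover big_ord0.
  have le_um : tnth u i <= m by apply: ltnW.
  have [le_qp|/ltnW le_pq] := leqP (block q i) (block p i).
    have := cover_exchange m_gt0 k le_qp le_um.
    have /eqP-> : block q i - block p i == 0 by []; rewrite !cover0; lia.
  have := cover_exchange m_gt0 k le_pq le_um.
  have /eqP-> : block p i - block q i == 0 by []; rewrite !cover0; lia.
have le_up k : up k <= up' k.
  have [->//|up_gt0] := posnP (up k); suff down0 : down k = 0.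
    by have := balance k; rewrite down0 addn0 => <-; apply: leq_addr.
  have /existsP[i /andP[lt_ki le_ki]] : [exists i : 'I_N, block q i < k <= block p i].
    move: up_gt0; rewrite lt0n; apply: contraR => /existsPn no_i.
    by rewrite /up big1 // => i _; rewrite (negPf (no_i i)).
  rewrite /down big1 // => i' _; apply/eqP; rewrite eqb0.
  apply/negP => /andP[lt_ki' le_ki'].
  (* Opposite crossings of [k] at [i] and [i'] contradict the monotonicity of [q] or of [p],
     depending on which position comes first. *)
  have [/leq_block le_ii'|/ltnW/leq_block le_i'i] := leqP i i'.
    by have := le_ii' q; lia.
  by have := le_i'i p; lia.
have sum_up : \sum_k up k = \sum_k up' k.
  rewrite exchange_big [RHS]exchange_big /=; apply: eq_bigr => i _.
  rewrite sum_cover // -[RHS](sum_cover m_gt0 (block p i)).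
  by apply: eq_bigr => k _; rewrite cover_interval ?ltn_block.
have /leqif_sum : forall k, true -> up k <= up' k ?= iff (up k == up' k).
  by move=> k _; split.
by move=> [_]; rewrite sum_up eqxx => /esym/forallP/(_ j)/eqP.
Qed.

Lemma successful_rightmost u p : successful u p -> rightmost_equitable u p.
Proof.
move=> suc_p; have eq_p := successful_equitable suc_p.
split=> // q eq_q i; case/successful_removal: (suc_p) => up rem size_p weight_u.
pose W k := [exists i : 'I_N, block q i < k <= block p i].
have [|||k x r lt_k /existsP[i1 /andP[lt_qk le_kp]] pk|_ empty_p] :=
    removal_closed (W := W) rem _ size_p _ _.
- by rewrite ltn_mod.
- by rewrite modn_mod weight_u.
- by apply/existsPn => i'; lia.
- have [i2 [block_i2 <- max_i2]] := block_last lt_k up pk.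
  pose j := Ordinal (ltn_pmod (k + m - tnth u i2) m_gt0).
  rewrite -[_ %% _]/(val j).
  (* Position [i1] is at or before [i2], so [q] places [i2] below [k] as well. *)
  have lt_q2 : block q i2 < k by apply: leq_ltn_trans lt_qk; rewrite leq_block ?max_i2.
  (* Level [j] is where the bottom descent of [i2] starts, so its term [t = 0] counts there. *)
  have : 0 < \sum_(i < N) (block q i < j <= block p i).
    rewrite (equitable_crossings j eq_p eq_q) (bigD1 i2) //= ltn_addr //.
    rewrite block_i2 /cover.
    have t0P : 0 < k - block q i2 by rewrite subn_gt0.
    by rewrite (bigD1 (Ordinal t0P)) //= addn0 modn_mod eqxx.
  rewrite lt0n; apply: contraR => /existsPn no_i.
  by rewrite big1 // => i' _; rewrite (negPf (no_i i')).
(* Otherwise column [block p i] is in [W], yet that block contains letter [i]. *)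
rewrite leqNgt; apply/negP => lt_qp.
have : tnth u i \in nth [::] p (block p i).
  by rewrite (block_letters _ up) ?ltn_block // map_f // mem_filter eqxx mem_enum.
rewrite empty_p ?ltn_block //; apply/existsP; exists i; rewrite lt_qp /=.
exact: leqnn.
Qed.

(** * Uniqueness and existence *)

Lemma rightmost_unique u p q :
  rightmost_equitable u p -> rightmost_equitable u q -> p = q.
Proof.
move=> [eq_p min_p] [eq_q min_q].
apply: (partition_inj (proj1 (andP eq_p)) (proj1 (andP eq_q))) => i.
by apply/eqP; rewrite eqn_leq min_p ?min_q.
Qed.

(* Inverts the removal procedure: w is the sequence of letters removed. *)
Fixpoint sweep (w : seq 'I_m) (L : nat) : seq (seq 'I_m) :=
  if w is x :: w' then
    let s := sweep w' ((L + m - x) %% m) in set_nth [::] s L (x :: nth [::] s L)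
  else nseq m [::].

Lemma size_sweep w L : L < m -> size (sweep w L) = m.
Proof.
elim: w L => [|x w IHw] L lt_L /=; first by rewrite size_nseq.
by rewrite size_set_nth IHw ?ltn_mod //; apply/maxn_idPr.
Qed.

(** One removal step undoes one insertion. *)
Lemma sweepK w (x : 'I_m) L : L < m -> let s := sweep w ((L + m - x) %% m) in
  set_nth [::] (sweep (x :: w) L) L (nth [::] s L) = s.
Proof.
move=> lt_L s; have size_s : size s = m by rewrite size_sweep ?ltn_mod.
rewrite /= -/s set_set_nth eqxx; apply: (@eq_from_nth _ [::]) => [|k _].
  by rewrite size_set_nth size_s; apply/maxn_idPr.
by rewrite nth_set_nth /=; case: eqP => [->|].
Qed.

Lemma removal_sweep w L : L < m -> removal (size w) (sweep w L) L.
Proof.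
elim: w L => [|x w IHw] L lt_L //.
have := sweepK w x lt_L; rewrite /= nth_set_nth /= eqxx => ->.
by rewrite IHw ?ltn_mod.
Qed.

(** The head of block [L] is the first letter, which determines the next level. *)
Lemma sweep_inj w w' L :
  L < m -> size w = size w' -> sweep w L = sweep w' L -> w = w'.
Proof.
elim: w w' L => [|x w IHw] [|x' w'] L //= lt_L [eq_size] eq_s.
have := congr1 (fun s => nth [::] s L) eq_s.
rewrite !nth_set_nth /= eqxx => -[eq_x eq_r]; subst x'; congr (_ :: _).
apply: (IHw _ ((L + m - x) %% m) (ltn_pmod _ m_gt0) eq_size).
by rewrite -(sweepK w x lt_L) -(sweepK w' x lt_L) /= eq_s eq_r.
Qed.

Lemma perm_flatten_sweep w L : L < m -> perm_eq (flatten (rev (sweep w L))) w.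
Proof.
move=> lt_L; apply/permP => a; rewrite count_flatten map_rev sumn_rev.
elim: w L lt_L => [|x w IHw] L lt_L; first by rewrite map_nseq sumn_nseq.
rewrite /= -(IHw _ (ltn_pmod (L + m - x) m_gt0)).
set s := sweep w _; have size_s : size s = m by rewrite size_sweep ?ltn_mod.
rewrite set_nthE size_s lt_L -[in RHS](cat_take_drop L s).
rewrite [in RHS](drop_nth [::]) ?size_s //.
by rewrite !map_cat !sumn_cat /= -addnA addnCA.
Qed.

(** By [size_sweep] the default of [insubd] is never taken. *)
Definition sweep_blocks (w : word m N) : blocks m :=
  insubd (nseq_tuple m [::]) (sweep w (weight w %% m)).

Lemma sweep_blocksE w : sweep_blocks w = sweep w (weight w %% m) :> seq _.
Proof. by rewrite val_insubd size_sweep ?ltn_mod ?eqxx. Qed.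

Lemma size_sweep_word w : size (flatten (rev (sweep_blocks w))) == N.
Proof.
by rewrite sweep_blocksE (perm_size (perm_flatten_sweep _ _)) ?ltn_mod ?size_tuple.
Qed.

Definition sweep_word w : word m N := Tuple (size_sweep_word w).

(** The two words are rearrangements of each other. Hence words with equal images start their walks
    at the same level, as [sweep_inj] requires. *)
Lemma weight_sweep w : weight (sweep_word w) = weight w.
Proof.
rewrite /weight -!(big_tuple _ _ _ predT (fun x : 'I_m => x : nat)) /=.
by apply: perm_big; rewrite sweep_blocksE perm_flatten_sweep ?ltn_mod.
Qed.

Lemma successful_sweep w : successful (sweep_word w) (sweep_blocks w).
Proof.
rewrite /successful /partition_of eqxx weight_sweep sweep_blocksE /=.
by rewrite -{1}(size_tuple w) removal_sweep ?ltn_mod.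
Qed.

Lemma sweep_word_inj : injective sweep_word.
Proof.
move=> w w' eq_w; have eq_b : sweep_blocks w = sweep_blocks w'.
  apply: (@rightmost_unique (sweep_word w)).
    exact/successful_rightmost/successful_sweep.
  by rewrite eq_w; apply/successful_rightmost/successful_sweep.
apply: val_inj.
apply: (@sweep_inj _ _ (weight w %% m)); rewrite ?ltn_mod ?size_tuple //.
rewrite -sweep_blocksE eq_b sweep_blocksE.
by rewrite -(weight_sweep w) eq_w weight_sweep.
Qed.

Lemma successful_exists u : exists p, successful u p.
Proof.
have [unsweep _ sweepwK] := injF_bij sweep_word_inj.
by exists (sweep_blocks (unsweep u)); rewrite -{1}(sweepwK u) successful_sweep.
Qed.

End Blocks.

Theorem theorem4p12 (m N : nat) (m_gt0 : 0 < m) (N_gt0 : 0 < N)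
    (u : word m N) :
  exists p : blocks m,
    unique (rightmost_equitable u) p /\ unique (successful u) p.
Proof.
have [p suc_p] := successful_exists m_gt0 u; exists p.
have right_p := successful_rightmost m_gt0 suc_p.
split; split=> // q; first exact: rightmost_unique.
by move/(successful_rightmost m_gt0); apply: rightmost_unique.
Qed.
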